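(* For every $\rho \in \mathcal{S}$, $\sigma \in \mathcal{P}$ and $\alpha\in(0,1)\cup(1,\infty)$, $D_{\alpha}^{\mathbb{P}}(\rho\|\sigma) = D_{\alpha}^{\mathbb{M}}(\rho\|\sigma)$.
   Context: Work on a $d$-dimensional complex Hilbert space; $\mathcal{P}$ denotes positive semidefinite operators, $\mathcal{S}$ density operators, $\log$ the natural logarithm. For a probability measure $P$ and positive measure $Q$ on a finite set $\mathcal{X}$ and $\alpha\in(0,1)\cup(1,\infty)$, the Rényi divergence is $D_\alpha(P\|Q)=\frac{1}{\alpha-1}\log\sum_x P(x)^\alpha Q(x)^{1-\alpha}$ (for $\alpha>1$ it is $+\infty$ unless $P\ll Q$, with terms $P(x)=0$ contributing $0$; for $\alpha<1$ it is $+\infty$ when the sum is $0$). A POVM $M$ on a finite set $\mathcal{X}$ maps $\mathcal{X}$ to positive semidefinite operators summing to the identity, inducing $P_{\rho,M}(x)=\operatorname{tr}[M(x)\rho]$. The measured Rényi relative entropy is $D^{\mathbb{M}}_\alpha(\rho\|\sigma):=\sup_{(\mathcal{X},M)}D_\alpha(P_{\rho,M}\|P_{\sigma,M})$ over all finite sets and POVMs. The projectively measured Rényi relative entropy is $D^{\mathbb{P}}_\alpha(\rho\|\sigma)=\frac{1}{\alpha-1}\log Q^{\mathbb{P}}_\alpha(\rho\|\sigma)$ where $Q^{\mathbb{P}}_\alpha(\rho\|\sigma)$ is $\sup$ (for $\alpha>1$) resp. $\min$ (for $\alpha\in(0,1)$) over families $\{P_i\}_{i=1}^d$ of mutually orthogonal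 rank-one projectors of $\sum_i \operatorname{tr}[P_i\rho]^\alpha\operatorname{tr}[P_i\sigma]^{1-\alpha}$ (with the same conventions for zeros). *)

(* Defs.v *)
From Stdlib Require Import Reals ClassicalEpsilon.
Open Scope R_scope.

Record C := mkC { Re : R; Im : R }.
Definition C0 : C := mkC 0 0.
Definition C1 : C := mkC 1 0.
Definition Cadd (a b : C) : C := mkC (Re a + Re b) (Im a + Im b).
Definition Cmul (a b : C) : C :=
  mkC (Re a * Re b - Im a * Im b) (Re a * Im b + Im a * Re b).
Definition Cconj (a : C) : C := mkC (Re a) (- Im a).

Fixpoint csum (n : nat) (f : nat -> C) : C :=
  match n with O => C0 | S k => Cadd (csum k f) (f k) end.
Fixpoint rsum (n : nat) (f : nat -> R) : R :=
  match n with O => 0 | S k => rsum k f + f k end.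

(** * Operators on C^d: only entries with indices < d are meaningful *)
Definition Vec := nat -> C.
Definition Mat := nat -> nat -> C.

Definition inner (d : nat) (u v : Vec) : C := csum d (fun i => Cmul (Cconj (u i)) (v i)).
Definition mapply (d : nat) (A : Mat) (v : Vec) : Vec :=
  fun i => csum d (fun j => Cmul (A i j) (v j)).
Definition mmul (d : nat) (A B : Mat) : Mat :=
  fun i j => csum d (fun k => Cmul (A i k) (B k j)).
Definition trace (d : nat) (A : Mat) : C := csum d (fun i => A i i).
Definition idm : Mat := fun i j => if Nat.eqb i j then C1 else C0.

Definition hermitian (d : nat) (A : Mat) : Prop :=
  forall i j, (i < d)%nat -> (j < d)%nat -> A i j = Cconj (A j i).
Definition psd (d : nat) (A : Mat) : Prop :=
  hermitian d A /\ forall v : Vec, 0 <= Re (inner d v (mapply d A v)).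
Definition density (d : nat) (A : Mat) : Prop := psd d A /\ trace d A = C1.

Definition povm (d n : nat) (M : nat -> Mat) : Prop :=
  (forall x, (x < n)%nat -> psd d (M x)) /\
  (forall i j, (i < d)%nat -> (j < d)%nat -> csum n (fun x => M x i j) = idm i j).

Definition induced (d : nat) (M : nat -> Mat) (rho : Mat) : nat -> R :=
  fun x => Re (trace d (mmul d (M x) rho)).

Definition rank1_proj (d : nat) (P : Mat) : Prop :=
  exists v : Vec, inner d v v = C1 /\
    forall i j, (i < d)%nat -> (j < d)%nat -> P i j = Cmul (v i) (Cconj (v j)).
Definition proj_family (d : nat) (P : nat -> Mat) : Prop :=
  (forall i, (i < d)%nat -> rank1_proj d (P i)) /\
  (forall i j, (i < d)%nat -> (j < d)%nat -> i <> j ->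
     forall a b, (a < d)%nat -> (b < d)%nat -> mmul d (P i) (P j) a b = C0).

Inductive ER := Fin (r : R) | PInf | NInf.
Definition ERle (x y : ER) : Prop :=
  match x, y with
  | NInf, _ => True
  | _, PInf => True
  | Fin a, Fin b => a <= b
  | _, _ => False
  end.
Definition is_sup (S : ER -> Prop) (v : ER) : Prop :=
  (forall x, S x -> ERle x v) /\ (forall u, (forall x, S x -> ERle x u) -> ERle v u).
Definition is_inf (S : ER -> Prop) (v : ER) : Prop :=
  (forall x, S x -> ERle v x) /\ (forall u, (forall x, S x -> ERle u x) -> ERle u v).
Definition ER_sup (S : ER -> Prop) : ER := epsilon (inhabits PInf) (is_sup S).
Definition ER_inf (S : ER -> Prop) : ER := epsilon (inhabits PInf) (is_inf S).

(** x^y with the convention 0^y = 0 (used only for y > 0 or with zero factor) *)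
Definition rpow (x y : R) : R := if Rlt_dec 0 x then Rpower x y else 0.

(** Q_alpha(P||Q) = sum_x P(x)^alpha Q(x)^(1-alpha), which is +oo for alpha > 1
    unless P << Q; terms with P(x) = 0 contribute 0. *)
Definition Qalpha (alpha : R) (n : nat) (P Q : nat -> R) : ER :=
  let s := rsum n (fun x => rpow (P x) alpha * rpow (Q x) (1 - alpha)) in
  if Rlt_dec 1 alpha then
    if excluded_middle_informative (exists x, (x < n)%nat /\ P x <> 0 /\ Q x = 0)
    then PInf else Fin s
  else Fin s.

(** (1/(alpha-1)) log q, on extended values (log 0 = -oo, log +oo = +oo) *)
Definition Dfrom (alpha : R) (q : ER) : ER :=
  match q with
  | Fin s => if Rlt_dec 0 s then Fin (ln s / (alpha - 1))
             else if Rlt_dec 1 alpha then NInf else PInf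
  | PInf => if Rlt_dec 1 alpha then PInf else NInf
  | NInf => if Rlt_dec 1 alpha then NInf else PInf
  end.

Definition renyi (alpha : R) (n : nat) (P Q : nat -> R) : ER := Dfrom alpha (Qalpha alpha n P Q).

Definition measured_set (d : nat) (alpha : R) (rho sigma : Mat) : ER -> Prop :=
  fun v => exists (n : nat) (M : nat -> Mat),
    povm d n M /\ v = renyi alpha n (induced d M rho) (induced d M sigma).
Definition D_meas (d : nat) (alpha : R) (rho sigma : Mat) : ER :=
  ER_sup (measured_set d alpha rho sigma).

Definition Qproj_set (d : nat) (alpha : R) (rho sigma : Mat) : ER -> Prop :=
  fun q => exists P : nat -> Mat,
    proj_family d P /\ q = Qalpha alpha d (induced d P rho) (induced d P sigma).
Definition Q_proj (d : nat) (alpha : R) (rho sigma : Mat) : ER :=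
  if Rlt_dec 1 alpha then ER_sup (Qproj_set d alpha rho sigma)
  else ER_inf (Qproj_set d alpha rho sigma).
Definition D_proj (d : nat) (alpha : R) (rho sigma : Mat) : ER :=
  Dfrom alpha (Q_proj d alpha rho sigma).

(* Main.v *)
(* For alpha > 1, P^alpha Q^(1-alpha) is the supremum over w > 0 of
   alpha P w^(1-1/alpha) + (1-alpha) Q w; for alpha < 1 it is the infimum.  Given a POVM M and
   near-optimal weights w_x, let omega = sum_x w_x M_x and measure projectively in an eigenbasis
   of omega.  The term linear in w is unchanged, and the power term can only improve by the
   operator Jensen inequality, since t^(1-1/alpha) is operator concave for alpha > 1 and operator
   convex for 1/2 <= alpha < 1; the case alpha < 1/2 follows by exchanging rho and sigma.
   Operator Jensen is elementary for the resolvents 1/(t+s) and passes to powers through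
   t^(q-1) = const * int e^(qs) / (t + e^s) ds.  Conversely an orthonormal family of d rank-one
   projectors is a POVM. *)
Require Import Defs.
From Stdlib Require Import Reals Lra Lia ClassicalEpsilon.
From mathcomp Require all_boot all_order all_algebra ring complex Rstruct.
From Coquelicot Require Import Hierarchy Continuity Derive RInt RInt_analysis AutoDerive.
From Coquelicot Require Import Lim_seq Rcomplements Rbar.
Open Scope R_scope.

(** * Positive semidefinite matrices and operator Jensen for the resolvent *)

Section Matrices.
Import all_boot all_order all_algebra ring complex Rstruct.
Import Defs.
Local Set Implicit Arguments.
Local Unset Strict Implicit.
Local Unset Printing Implicit Defensive.
Import Order.TTheory GRing.Theory Num.Theory.
Local Open Scope ring_scope.
Local Open Scope sesquilinear_scope.

Section Psd.
Variables (K : numClosedFieldType).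

(** The order of a [numClosedFieldType] is partial: [0 <= z] also says that [z] is real. *)
Definition psdmx n (A : 'M[K]_n) : Prop :=
  A^t* = A /\ forall v : 'cV[K]_n, 0 <= (v^t* *m A *m v) 0 0.

Lemma trmxC_mul m n p (A : 'M[K]_(m, n)) (B : 'M[K]_(n, p)) :
  (A *m B)^t* = B^t* *m A^t*.
Proof. by rewrite trmx_mul map_mxM. Qed.

Lemma gram_diag_ge0 m n (X : 'M[K]_(m, n)) i : 0 <= (X^t* *m X) i i.
Proof.
rewrite mxE sumr_ge0 // => j _.
by rewrite !mxE mulrC mul_conjC_ge0.
Qed.

Lemma tr_gram_ge0 m n (X : 'M[K]_(m, n)) : 0 <= \tr (X^t* *m X).
Proof. by apply: sumr_ge0 => i _; exact: gram_diag_ge0. Qed.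

Lemma psdmx_gram m n (X : 'M[K]_(m, n)) : psdmx (X^t* *m X).
Proof.
split; first by rewrite trmxC_mul trmxCK.
by move=> v; rewrite mulmxA -mulmxA -trmxC_mul gram_diag_ge0.
Qed.

Lemma spectral_decomposition n (A : 'M[K]_n) : A^t* = A ->
  exists U : 'M[K]_n, exists b : 'rV[K]_n,
    [/\ U *m U^t* = 1%:M, U^t* *m U = 1%:M & A = U^t* *m diag_mx b *m U].
Proof.
move=> Aherm; have Un := spectral_unitarymx A.
exists (spectralmx A), (spectral_diag A); split; first exact/unitarymxP.
  by apply: mulmx1C; exact/unitarymxP.
have /orthomx_spectralP : A \is normalmx by apply/normalmxP; rewrite Aherm.
by rewrite invmx_unitary.
Qed.

(** Reads an eigenvalue as a diagonal entry of [U *m A *m U^t*], so that signs of eigenvalues come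
    from quadratic forms. *)
Lemma diag_conj_entry n (U : 'M[K]_n) (b : 'rV[K]_n) i :
  U *m U^t* = 1%:M ->
  b 0 i = (U *m (U^t* *m diag_mx b *m U) *m U^t*) i i.
Proof.
by move=> UU; rewrite !mulmxA UU mul1mx -mulmxA UU mulmx1 mxE eqxx.
Qed.

Lemma psdmx_conj_diag_ge0 n (A U : 'M[K]_n) i : psdmx A ->
  0 <= (U *m A *m U^t*) i i.
Proof.
move=> [_ /(_ ((row i U)^t* ))]; rewrite trmxCK -row_mul.
by congr (0 <= _); rewrite !mxE; apply: eq_bigr => j _; rewrite !mxE.
Qed.

(** Take square roots of the eigenvalues, which are nonnegative as values of the quadratic form at
    the eigenvectors. *)
Lemma psdmx_factor n (A : 'M[K]_n) : psdmx A -> exists B : 'M[K]_n, A = B^t* *m B.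
Proof.
move=> psdA; have [U [b [UU _ AE]]] := spectral_decomposition psdA.1.
have b_ge0 i : 0 <= b 0 i.
  by rewrite (diag_conj_entry _ _ UU) -AE psdmx_conj_diag_ge0.
exists (diag_mx (map_mx sqrtC b) *m U).
rewrite trmxC_mul AE -!mulmxA; congr (_ *m _); rewrite mulmxA; congr (_ *m _).
apply/matrixP => i j; rewrite tr_diag_mx map_diag_mx mul_diag_mx !mxE.
case: eqVneq => [_|_]; last by rewrite !mulr0n mulr0.
by rewrite !mulr1n /= geC0_conj ?sqrtC_ge0 // -expr2 sqrtCK.
Qed.

(** With both factors written as Gram matrices, cyclicity turns the trace into that of the Gram
    matrix of [X *m Y^t*]. *)
Lemma tr_psdmx_mul_ge0 n (A B : 'M[K]_n) : psdmx A -> psdmx B -> 0 <= \tr (A *m B).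
Proof.
move=> /psdmx_factor[X ->] /psdmx_factor[Y ->].
have -> : \tr (X^t* *m X *m (Y^t* *m Y)) = \tr ((X *m Y^t*)^t* *m (X *m Y^t*)).
  by rewrite trmxC_mul trmxCK mulmxA mxtrace_mulC !mulmxA.
exact: tr_gram_ge0.
Qed.

Lemma psdmx_conj n (A B : 'M[K]_n) : psdmx A -> psdmx (B^t* *m A *m B).
Proof.
move=> /psdmx_factor[X ->].
have -> : B^t* *m (X^t* *m X) *m B = (X *m B)^t* *m (X *m B).
  by rewrite trmxC_mul !mulmxA.
exact: psdmx_gram.
Qed.

Section SpectralFamily.
Variables (n m : nat) (M : 'I_m -> 'M[K]_n) (w : 'I_m -> K).
Hypothesis psdM : forall x, psdmx (M x).
Hypothesis sumM : \sum_x M x = 1%:M.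
Hypothesis w_gt0 : forall x, 0 < w x.

Let W := \sum_x w x *: M x.

Lemma weighted_sum_herm : W^t* = W.
Proof.
rewrite /W (raddf_sum (@trmx K n n)) raddf_sum; apply: eq_bigr => x _ /=.
by rewrite linearZ /= map_mxZ (psdM x).1 /= geC0_conj // ltW.
Qed.

(* Expanding (1 - aY) M (1 - aY) >= 0 at a = w x + s, where Y = (W + s)^-1, and averaging
   over x with weights 1 / a yields the operator Jensen inequality for the resolvent. *)
Lemma resolvent_jensen (Y rho : 'M[K]_n) (s : K) :
  Y^t* = Y -> Y *m (W + s%:M) = 1%:M -> 0 <= s -> psdmx rho ->
  \tr (Y *m rho) <= \sum_x \tr (M x *m rho) / (w x + s).
Proof.
move=> Yherm Yinv s_ge0 psdrho.
have a_gt0 x : 0 < w x + s by rewrite ltr_pwDl.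
pose Z x := 1%:M - (w x + s) *: Y.
have Zherm x : (Z x)^t* = Z x.
  rewrite /Z linearB /= trmx1 map_mxB map_mx1 linearZ /= map_mxZ Yherm /=.
  by rewrite geC0_conj // ltW.
have term_ge0 x : 0 <= (w x + s)^-1 * \tr (Z x *m M x *m Z x *m rho).
  rewrite mulr_ge0 ?invr_ge0 ?(ltW (a_gt0 x)) // tr_psdmx_mul_ge0 //.
  by rewrite -{1}(Zherm x); exact: psdmx_conj.
have termE x : (w x + s)^-1 * \tr (Z x *m M x *m Z x *m rho) =
    \tr (M x *m rho) / (w x + s) - \tr (M x *m Y *m rho) - \tr (Y *m M x *m rho)
    + \tr (Y *m ((w x + s) *: M x) *m Y *m rho).
  have a_neq0 : w x + s != 0 by rewrite gt_eqF.
  rewrite /Z !(mulmxBl, mulmxBr) !(mul1mx, mulmx1) -!(scalemxAl, scalemxAr).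
  rewrite !(raddfB (@mxtrace K n)) /= !mxtraceZ.
  by field.
have : 0 <= \sum_x (w x + s)^-1 * \tr (Z x *m M x *m Z x *m rho).
  by apply: sumr_ge0 => x _; exact: term_ge0.
under eq_bigr do rewrite termE.
rewrite big_split /= !sumrB -!raddf_sum /= -!mulmx_suml -!mulmx_sumr sumM.
have -> : \sum_x (w x + s) *: M x = W + s%:M.
  rewrite -scalemx1 -sumM scaler_sumr -big_split.
  by apply: eq_bigr => x _; rewrite scalerDl.
(* The two cross terms give [- 2 * \tr (Y *m rho)]; since [Y] inverts [W + s], the quadratic term
   gives one [\tr (Y *m rho)] back. *)
rewrite Yinv !mul1mx mulmx1.
by rewrite subrK subr_ge0.
Qed.

(** Diagonalize [W]; the [p i] are then the outcome probabilities in its eigenbasis. Traces of [rho]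
    against [1], [W] and the resolvent of [W] become sums over [p], and the last is bounded by
    [resolvent_jensen]. The basis is chosen before [rho], so one measurement serves two
    operators. *)
Lemma spectral_family_mx :
  exists U : 'M[K]_n, exists b : 'I_n -> K,
  [/\ U *m U^t* = 1%:M, U^t* *m U = 1%:M, forall i, 0 < b i &
  forall rho : 'M[K]_n, psdmx rho ->
    let p i := (U *m rho *m U^t*) i i in
    let P x := \tr (M x *m rho) in
    [/\ \sum_i p i = \sum_x P x, \sum_i b i * p i = \sum_x w x * P x &
    forall s, 0 <= s -> \sum_i p i / (b i + s) <= \sum_x P x / (w x + s)]].
Proof.
have [U [b [UU UU' WE]]] := spectral_decomposition weighted_sum_herm.
have tr_diag (c : 'rV[K]_n) (rho : 'M[K]_n) :
    \tr (U^t* *m diag_mx c *m U *m rho) = \sum_i c 0 i * (U *m rho *m U^t*) i i.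
  rewrite -!mulmxA mxtrace_mulC -!mulmxA mul_diag_mx.
  by apply: eq_bigr => i _; rewrite mxE !mulmxA.
have b_gt0 i : 0 < b 0 i.
  rewrite (diag_conj_entry _ _ UU) -WE /W mulmx_sumr mulmx_suml summxE.
  have M_ge0 x := psdmx_conj_diag_ge0 U i (psdM x).
  have E x : (U *m (w x *: M x) *m U^t*) i i = w x * (U *m M x *m U^t*) i i.
    by rewrite -scalemxAr -scalemxAl mxE.
  under eq_bigr do rewrite E.
  rewrite lt_neqAle eq_sym sumr_ge0 ?andbT; last first.
    by move=> x _; rewrite mulr_ge0 // ltW.
  apply/eqP => /psumr_eq0P H.
  have : (U *m U^t*) i i = 0.
    rewrite -[X in X *m _]mulmx1 -sumM mulmx_sumr mulmx_suml summxE big1 // => x _.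
    have /eqP := H (fun x _ => mulr_ge0 (ltW (w_gt0 x)) (M_ge0 x)) x isT.
    by rewrite mulf_eq0 gt_eqF //= => /eqP.
  by rewrite UU mxE eqxx => /eqP; rewrite oner_eq0.
exists U, (fun i => b 0 i); split=> // rho psdrho p P; split.
- rewrite -[LHS]/(\tr (U *m rho *m U^t*)) mxtrace_mulC mulmxA UU' mul1mx.
  by rewrite -raddf_sum /= -mulmx_suml sumM mul1mx.
- rewrite -tr_diag -WE /W mulmx_suml raddf_sum /=.
  by apply: eq_bigr => x _; rewrite -scalemxAl mxtraceZ.
(* The eigenvalues of the resolvent of [W] at [s]. *)
move=> s s_ge0; pose c := \row_i (b 0 i + s)^-1.
have c_neq0 i : b 0 i + s != 0 by rewrite gt_eqF // ltr_pwDl.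
have := @resolvent_jensen (U^t* *m diag_mx c *m U) rho s.
rewrite tr_diag; under eq_bigr do rewrite mxE mulrC; apply => //.
- rewrite !trmxC_mul trmxCK tr_diag_mx map_diag_mx mulmxA; congr (_ *m diag_mx _ *m _).
  by apply/rowP => i; rewrite !mxE /= geC0_conj // invr_ge0 addr_ge0 // ltW.
- have -> : W + s%:M = U^t* *m diag_mx (\row_i (b 0 i + s)) *m U.
    have sE : s%:M = U^t* *m s%:M *m U by rewrite scalar_mxC -mulmxA UU' mulmx1.
    rewrite {1}WE {1}sE -mulmxDl -mulmxDr; congr (_ *m _ *m _).
    by apply/matrixP => i j; rewrite !mxE -mulrnDl.
  rewrite !mulmxA -[_ *m U *m _]mulmxA UU mulmx1 -[_ *m diag_mx _ *m diag_mx _]mulmxA.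
  rewrite mulmx_diag -[RHS]UU'; congr (_ *m _); rewrite -[RHS]mulmx1; congr (_ *m _).
  by apply/matrixP => i j; rewrite !mxE mulVf.
Qed.

End SpectralFamily.
End Psd.

(** * Transfer between operators as functions on [nat] and matrices over [complex R] *)

Section Transfer.
Notation R := Rdefinitions.R.
Notation Ci := (complex R).

Definition toC (z : Defs.C) : Ci := Complex (Defs.Re z) (Defs.Im z).
Definition ofC (z : Ci) : Defs.C := mkC (complex.Re z) (complex.Im z).
Definition mx_of d (A : Mat) : 'M[Ci]_d := \matrix_(i, j) toC (A i j).
Definition cV_of d (v : Vec) : 'cV[Ci]_d := \col_i toC (v i).

Lemma toC_inj : injective toC.
Proof. by move=> [a b] [c e] [-> ->]. Qed.

Lemma ofCK : cancel ofC toC.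
Proof. by case. Qed.

Lemma toCM a b : toC (Cmul a b) = toC a * toC b.
Proof. by case: a b => [? ?] [? ?]. Qed.

Lemma toC_conj a : toC (Cconj a) = (toC a)^*.
Proof. by case: a. Qed.

Lemma toC_sum n f : toC (csum n f) = \sum_(i < n) toC (f i).
Proof.
elim: n => [|n IHn]; first by rewrite big_ord0.
by rewrite big_ord_recr -IHn.
Qed.

Lemma rsumE n f : rsum n f = \sum_(i < n) f i.
Proof.
elim: n => [|n IHn]; first by rewrite big_ord0.
by rewrite big_ord_recr -IHn.
Qed.

Lemma Re_sum n (f : 'I_n -> Ci) : complex.Re (\sum_i f i) = \sum_i complex.Re (f i).
Proof. by apply: (big_morph (@complex.Re R)) => // [[? ?] [? ?]]. Qed.

Lemma mx_ofM d A B : mx_of d (mmul d A B) = mx_of d A *m mx_of d B.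
Proof.
apply/matrixP => i j; rewrite !mxE toC_sum; apply: eq_bigr => k _.
by rewrite toCM !mxE.
Qed.

Lemma inducedE d M rho x :
  induced d M rho x = complex.Re (\tr (mx_of d (M x) *m mx_of d rho)).
Proof.
rewrite -mx_ofM /induced -[RHS]/(complex.Re (\tr _)).
have -> : \tr (mx_of d (mmul d (M x) rho)) = toC (trace d (mmul d (M x) rho)).
  by rewrite toC_sum; apply: eq_bigr => i _; rewrite mxE.
by [].
Qed.

Lemma innerE d u v : toC (inner d u v) = ((cV_of d u)^t* *m cV_of d v) 0 0.
Proof.
by rewrite toC_sum mxE; apply: eq_bigr => i _; rewrite toCM toC_conj !mxE.
Qed.

Lemma mapplyE d A v : cV_of d (mapply d A v) = mx_of d A *m cV_of d v.
Proof.
apply/matrixP => i j; rewrite !mxE toC_sum; apply: eq_bigr => k _.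
by rewrite toCM !mxE.
Qed.

Lemma cV_of_surj d (v : 'cV[Ci]_d) : exists u, cV_of d u = v.
Proof.
exists (fun i => if insub i is Some k then ofC (v k 0) else C0).
by apply/matrixP => i j; rewrite !mxE valK ofCK ord1.
Qed.

Lemma hermitianE d A : hermitian d A <-> (mx_of d A)^t* = mx_of d A.
Proof.
split=> [H|/matrixP H i j /ssrnat.ltP hi /ssrnat.ltP hj].
  apply/matrixP => i j; rewrite !mxE (H i j); try exact/ssrnat.ltP.
  by rewrite toC_conj.
by have := H (Ordinal hi) (Ordinal hj); rewrite !mxE -toC_conj => /toC_inj ->.
Qed.

Lemma psdE d A : psd d A <-> psdmx (mx_of d A).
Proof.
rewrite /psd /psdmx hermitianE; split=> -[Aherm H]; split=> // v.
  have [u <-] := cV_of_surj v.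
  rewrite -mulmxA -mapplyE -innerE lecE; apply/andP; split; last exact/RleP/H.
  (* [psd] constrains only the real part of the form; the imaginary part vanishes because a
     Hermitian form equals its own conjugate. *)
  have : (toC (inner d u (mapply d A u)))^* = toC (inner d u (mapply d A u)).
    rewrite innerE mapplyE mulmxA.
    set X := _ *m _; have : X^t* = X by rewrite /X !trmxC_mul trmxCK Aherm mulmxA.
    by move=> /matrixP/(_ 0 0); rewrite !mxE.
  case: (toC _) => a b [] /eqP; rewrite -subr_eq0 -opprD oppr_eq0 -mulr2n.
  by rewrite mulrn_eq0.
have := H (cV_of d v); rewrite -mulmxA -mapplyE -innerE lecE => /andP[_ /RleP].
by [].
Qed.

Lemma idmE d : mx_of d idm = 1%:M.
Proof.
apply/matrixP => i j; rewrite !mxE /idm.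
have -> : Nat.eqb i j = (i == j) by apply/PeanoNat.Nat.eqb_spec/eqP => [/val_inj|->].
by case: eqP.
Qed.

Lemma povmE d n M : povm d n M <->
  (forall x : 'I_n, psdmx (mx_of d (M x))) /\ \sum_(x < n) mx_of d (M x) = 1%:M.
Proof.
rewrite /povm -idmE; split=> -[H1 H2]; split.
- by move=> x; apply/psdE/H1/ssrnat.ltP.
- apply/matrixP => i j; rewrite summxE mxE -H2; try exact/ssrnat.ltP.
  by rewrite toC_sum; apply: eq_bigr => x _; rewrite mxE.
- by move=> x /ssrnat.ltP hx; apply/psdE/(H1 (Ordinal hx)).
move=> i j /ssrnat.ltP hi /ssrnat.ltP hj; have /matrixP/(_ (Ordinal hi) (Ordinal hj)) := H2.
rewrite summxE !mxE => E; apply: toC_inj; rewrite -E toC_sum.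
by apply: eq_bigr => x _; rewrite mxE.
Qed.

Lemma rank1_projE d P : rank1_proj d P <->
  exists2 V : 'cV[Ci]_d, V^t* *m V = 1%:M & mx_of d P = V *m V^t*.
Proof.
split=> [[v [v1 PE]]|[V V1 PE]].
  exists (cV_of d v).
    by apply/matrixP => i j; rewrite !ord1 -innerE v1 mxE.
  apply/matrixP => i j; rewrite !mxE big_ord1 PE; try exact/ssrnat.ltP.
  by rewrite toCM toC_conj !mxE.
have [v vE] := cV_of_surj V; exists v; split.
  by apply: toC_inj; rewrite innerE vE V1 mxE.
move=> i j /ssrnat.ltP hi /ssrnat.ltP hj; apply: toC_inj.
have /matrixP/(_ (Ordinal hi) (Ordinal hj)) := PE.
by rewrite -vE !mxE big_ord1 toCM toC_conj !mxE.
Qed.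

Lemma induced_nonneg (d n : nat) (M : nat -> Mat) (rho : Mat) (x : nat) :
  povm d n M -> psd d rho -> (x < n)%coq_nat -> Rle 0 (induced d M rho x).
Proof.
move=> [psdM _] /psdE psdrho /psdM /psdE psdMx; apply/RleP; rewrite inducedE.
by have := tr_psdmx_mul_ge0 psdMx psdrho; rewrite lecE => /andP[].
Qed.

(** The [d] range vectors are orthonormal in dimension [d]. The square matrix [U] with their
    adjoints as rows satisfies [U *m U^t* = 1], hence [U^t* *m U = 1], which is the completeness
    relation. *)
Lemma proj_family_povm (d : nat) (P : nat -> Mat) : proj_family d P -> povm d d P.
Proof.
move=> [rankP orthP].
have : forall i : 'I_d, exists V : 'cV[Ci]_d,
    V^t* *m V = 1%:M /\ mx_of d (P i) = V *m V^t*.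
  by move=> i; have /rank1_projE[V V1 VE] := rankP i (ssrnat.ltP (ltn_ord i)); exists V.
move=> /fin_all_exists[V VP].
(* Sandwiching the zero product of projectors between [(V i)^t*] and [V j] leaves the inner product
   of the two vectors. *)
have orthV i j : i != j -> (V i)^t* *m V j = 0.
  move=> ij; have : mx_of d (P i) *m mx_of d (P j) = 0.
    rewrite -mx_ofM; apply/matrixP => a b; rewrite !mxE orthP //; try exact/ssrnat.ltP.
    by move=> /val_inj /eqP; apply/negP.
  rewrite !(VP _).2 => /(congr1 (fun X => (V i)^t* *m X *m V j)).
  by rewrite !mulmxA (VP i).1 mul1mx -[_ *m _ *m V j]mulmxA (VP j).1 mulmx1 mulmx0 mul0mx.
pose U : 'M[Ci]_d := \matrix_(i, j) ((V i) j 0)^*.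
have UUE i j : (U *m U^t*) i j = ((V i)^t* *m V j) 0 0.
  by rewrite !mxE; apply: eq_bigr => k _; rewrite !mxE conjCK.
have UU : U *m U^t* = 1%:M.
  apply/matrixP => i j; rewrite UUE [RHS]mxE.
  by have [->|/orthV ->] := eqVneq i j; rewrite ?(VP j).1 mxE.
apply/povmE; split=> [x|].
  by rewrite (VP x).2 -{1}[V x]trmxCK; exact: psdmx_gram.
rewrite -(mulmx1C UU); apply/matrixP => i j; rewrite summxE mxE.
by apply: eq_bigr => x _; rewrite (VP x).2 !mxE big_ord1 !mxE conjCK.
Qed.

Lemma spectral_family (d n : nat) (M : nat -> Mat) (w : nat -> R) :
  povm d n M -> (forall x, (x < n)%coq_nat -> Rlt 0 (w x)) ->
  exists (P : nat -> Mat) (b : nat -> R),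
    proj_family d P /\ (forall i, (i < d)%coq_nat -> Rlt 0 (b i)) /\
    forall rho, psd d rho ->
      rsum d (induced d P rho) = rsum n (induced d M rho) /\
      rsum d (fun i => Rmult (b i) (induced d P rho i)) =
        rsum n (fun x => Rmult (w x) (induced d M rho x)) /\
      forall s, Rle 0 s ->
        Rle (rsum d (fun i => Rdiv (induced d P rho i) (Rplus (b i) s)))
            (rsum n (fun x => Rdiv (induced d M rho x) (Rplus (w x) s))).
Proof.
move=> /povmE[psdM sumM] w_gt0.
have wC_gt0 (x : 'I_n) : 0 < real_complex R (w x).
  by rewrite ltcR; apply/RltP/w_gt0/ssrnat.ltP.
have [U [b [UU UU' b_gt0 H]]] := spectral_family_mx psdM sumM wC_gt0.
(* [ext] pads with the default [z] at indices from [d] on. In [P] below, [insubd i] likewise sends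
   an index out of range to [i]; only entries with indices below [d] are ever read. *)
pose ext T (z : T) (f : 'I_d -> T) (i : nat) := if insub i is Some k then f k else z.
have extE T z (f : 'I_d -> T) (i : 'I_d) : ext T z f i = f i by rewrite /ext valK.
pose P := ext Mat (fun _ _ => C0)
  (fun i a c => ofC (((row i U)^t* *m row i U) (insubd i a) (insubd i c))).
have PE (i : 'I_d) : mx_of d (P i) = (row i U)^t* *m row i U.
  by apply/matrixP => a c; rewrite [LHS]mxE /P extE ofCK !valKd.
have rowUU i j : row i U *m (row j U)^t* = (i == j)%:R%:M.
  apply/matrixP => k l; rewrite !ord1 [RHS]mxE eqxx mulr1n.
  have /matrixP/(_ i j) := UU; rewrite [RHS]mxE => <-; rewrite !mxE.
  by apply: eq_bigr => c _; rewrite !mxE.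
have bE i : real_complex R (complex.Re (b i)) = b i.
  by rewrite RRe_real // ger0_real // ltW.
exists P, (ext R 0 (fun i => complex.Re (b i))); split; [|split].
- split.
    move=> i /ssrnat.ltP hi; apply/rank1_projE; exists ((row (Ordinal hi) U)^t* ).
      by rewrite trmxCK rowUU eqxx.
    by rewrite trmxCK -PE.
  move=> i j /ssrnat.ltP hi /ssrnat.ltP hj ij a c /ssrnat.ltP ha /ssrnat.ltP hc; apply: toC_inj.
  have : mx_of d (P (Ordinal hi)) *m mx_of d (P (Ordinal hj)) = 0.
    rewrite !PE mulmxA -[_ *m _ *m (_^t*)]mulmxA.
    rewrite rowUU; have -> : (Ordinal hi == Ordinal hj) = false by apply/eqP => -[].
    by rewrite raddf0 mulmx0 mul0mx.
  rewrite -mx_ofM => /matrixP/(_ (Ordinal ha) (Ordinal hc)).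
  by rewrite !mxE.
- move=> i /ssrnat.ltP hi; apply/RltP; rewrite (extE R 0 _ (Ordinal hi)).
  by rewrite -ltcR bE.
move=> rho /psdE psdrho; have [Htr Hlin Hres] := H _ psdrho.
(* By cyclicity, the trace against a rank-one projector is the diagonal entry of [rho] in the
   eigenbasis. *)
have pE (i : 'I_d) : induced d P rho i = complex.Re ((U *m mx_of d rho *m U^t*) i i).
  rewrite inducedE PE; congr (complex.Re _).
  rewrite -[X in \tr X]mulmxA mxtrace_mulC trace_mx11 -row_mul !mxE; apply: eq_bigr => k _.
  by rewrite !mxE.
have ReM (r : R) (z : Ci) : complex.Re (real_complex R r * z) = r * complex.Re z.
  by case: z => u v /=; rewrite mul0r subr0.
have ReV (r s : R) (z : Ci) :
    complex.Re (z / (real_complex R r + real_complex R s)) = complex.Re z / (r + s).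
  by rewrite -rmorphD -fmorphV mulrC ReM mulrC.
rewrite !rsumE; split; [|split].
- under eq_bigr do rewrite pE; under [RHS]eq_bigr do rewrite inducedE.
  by rewrite -!Re_sum Htr.
- under eq_bigr do rewrite pE extE RmultE -ReM bE.
  under [RHS]eq_bigr do rewrite inducedE RmultE -ReM.
  by rewrite -!Re_sum Hlin.
move=> s /RleP s_ge0; apply/RleP; rewrite !rsumE.
under eq_bigr do rewrite pE extE RdivE RplusE -ReV bE.
under [leRHS]eq_bigr do rewrite inducedE RdivE RplusE -ReV.
rewrite -!Re_sum.
have := Hres (real_complex R s); rewrite ler0c s_ge0 => /(_ isT).
by rewrite lecE => /andP[].
Qed.

End Transfer.

End Matrices.

(** * From resolvents to powers *)

Lemma rsum_ext (n : nat) (f g : nat -> R) :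
  (forall k, (k < n)%nat -> f k = g k) -> rsum n f = rsum n g.
Proof.
  induction n as [|n IH]; simpl; intros H; [reflexivity|].
  rewrite IH, H; auto; intros; apply H; lia.
Qed.

Lemma rsum_le (n : nat) (f g : nat -> R) :
  (forall k, (k < n)%nat -> f k <= g k) -> rsum n f <= rsum n g.
Proof.
  induction n as [|n IH]; simpl; intros H; [lra|].
  apply Rplus_le_compat; [apply IH; intros; apply H; lia | apply H; lia].
Qed.

Lemma rsum_plus (n : nat) (f g : nat -> R) :
  rsum n (fun k => f k + g k) = rsum n f + rsum n g.
Proof. induction n as [|n IH]; simpl; [lra|rewrite IH; lra]. Qed.

Lemma rsum_scal (n : nat) (a : R) (f : nat -> R) :
  rsum n (fun k => a * f k) = a * rsum n f.
Proof. induction n as [|n IH]; simpl; [lra|rewrite IH; lra]. Qed.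

Lemma rsum_const (n : nat) (a : R) : rsum n (fun _ => a) = INR n * a.
Proof. induction n as [|n IH]; [simpl; lra|]. rewrite S_INR. simpl; rewrite IH; lra. Qed.

Lemma rsum_RInt (n : nat) (f : nat -> R -> R) (a b : R) :
  (forall k, (k < n)%nat -> ex_RInt (f k) a b) ->
  is_RInt (fun s => rsum n (fun k => f k s)) a b (rsum n (fun k => RInt (f k) a b)).
Proof.
  induction n as [|n IH]; intros H; simpl.
  - assert (E := @is_RInt_const R_NormedModule a b 0).
    unfold scal in E; simpl in E; unfold mult in E; simpl in E.
    now rewrite Rmult_0_r in E.
  - apply @is_RInt_plus; [apply IH; intros; apply H; lia|].
    apply (@RInt_correct R_CompleteNormedModule), H; lia.
Qed.

Lemma rsum_lim (n : nat) (f : nat -> nat -> R) (l : nat -> R) :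
  (forall k, (k < n)%nat -> is_lim_seq (f k) (l k)) ->
  is_lim_seq (fun N => rsum n (fun k => f k N)) (rsum n l).
Proof.
  induction n as [|n IH]; intros H; simpl.
  - apply is_lim_seq_const.
  - apply is_lim_seq_plus'; [apply IH; intros; apply H; lia | apply H; lia].
Qed.

(** * The integral kernel of the power function *)

(** The integrand of [int_0^oo x^(q-1) / (t + x) dx = const * t^(q-1)] after [x = exp s]. It is
    integrated only over [[-N, N]] and normalized by its value at [t = 1], so neither an improper
    integral nor the constant is needed. *)
Definition kern (q t s : R) : R := exp (q * s) / (t + exp s).

Lemma kern_pos (q t s : R) : 0 < t -> 0 < kern q t s.
Proof.
  intros Ht. apply Rdiv_lt_0_compat; [apply exp_pos|].
  generalize (exp_pos s); lra.
Qed.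

Lemma kern_continuous (q t s : R) : 0 < t -> continuous (kern q t) s.
Proof.
  intros Ht. apply @ex_derive_continuous. unfold kern. auto_derive.
  generalize (exp_pos s); lra.
Qed.

Lemma kern_ex_RInt (q t a b : R) : 0 < t -> ex_RInt (kern q t) a b.
Proof. intros Ht. apply (@ex_RInt_continuous R_CompleteNormedModule). intros; now apply kern_continuous. Qed.

Lemma kern_scale (q t s : R) : 0 < t ->
  kern q t (1 * s + ln t) = Rpower t (q - 1) * kern q 1 s.
Proof.
  intros Ht. unfold kern, Rpower.
  rewrite Rmult_1_l, exp_plus, exp_ln by assumption.
  replace (q * (s + ln t)) with ((q - 1) * ln t + ln t + q * s) by ring.
  rewrite !exp_plus, exp_ln by assumption.
  generalize (exp_pos s); intros. field. split; nra.
Qed.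

(* Substituting s + ln t for s turns the integral at t into the one at 1 over a shifted window. *)
Lemma kern_RInt_scale (q t N : R) : 0 < t ->
  RInt (kern q t) (- N) N =
  Rpower t (q - 1) * RInt (kern q 1) (- N - ln t) (N - ln t).
Proof.
  intros Ht.
  assert (H : is_RInt (fun s => scal 1 (kern q t (1 * s + ln t)))
     (- N - ln t) (N - ln t) (RInt (kern q t) (- N) N)).
  { apply @is_RInt_comp_lin.
    replace (1 * (- N - ln t) + ln t) with (- N) by ring.
    replace (1 * (N - ln t) + ln t) with N by ring.
    apply (@RInt_correct R_CompleteNormedModule), kern_ex_RInt, Ht. }
  apply (@is_RInt_unique R_CompleteNormedModule) in H. rewrite <- H.
  rewrite <- (@RInt_scal R_CompleteNormedModule) by (apply kern_ex_RInt; lra).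
  apply RInt_ext; intros s _. rewrite kern_scale by assumption.
  unfold scal; simpl; unfold mult; simpl; ring.
Qed.

(** Bound the denominator below by [exp s] for [s >= 0], leaving decay rate [1 - q], and by 1 for
    [s < 0], leaving rate [q]. *)
Lemma kern_tail (q s x : R) : 0 < q < 1 -> 0 <= x <= Rabs s ->
  kern q 1 s <= exp (- Rmin q (1 - q) * x).
Proof.
  intros Hq Hx. unfold kern.
  assert (Hm1 := Rmin_l q (1 - q)). assert (Hm2 := Rmin_r q (1 - q)).
  assert (Hm0 : 0 < Rmin q (1 - q)) by (apply Rmin_pos; lra).
  assert (He := exp_pos s).
  assert (Hle : forall a b, a <= b -> exp a <= exp b).
  { intros a b [H|H]; [left; now apply exp_increasing|rewrite H; lra]. }
  apply Rle_div_l; [lra|].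
  destruct (Rle_dec 0 s) as [H|H].
  - rewrite Rabs_pos_eq in Hx by lra.
    apply Rle_trans with (exp (- Rmin q (1 - q) * x) * exp s).
    + rewrite <- exp_plus. apply Hle. nra.
    + generalize (exp_pos (- Rmin q (1 - q) * x)); nra.
  - rewrite Rabs_left1 in Hx by lra.
    apply Rle_trans with (exp (- Rmin q (1 - q) * x) * 1).
    + rewrite Rmult_1_r. apply Hle. nra.
    + generalize (exp_pos (- Rmin q (1 - q) * x)); nra.
Qed.

(** Length times a uniform bound. Both orientations of the interval are allowed because [kern_shift]
    applies it with a shift of unknown sign. *)
Lemma kern_RInt_tail (q a b x : R) : 0 < q < 1 -> 0 <= x ->
  (forall s, Rmin a b <= s <= Rmax a b -> x <= Rabs s) ->
  Rabs (RInt (kern q 1) a b) <= Rabs (b - a) * exp (- Rmin q (1 - q) * x).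
Proof.
  intros Hq Hx H.
  assert (Hw : forall a b, a <= b -> (forall s, a <= s <= b -> x <= Rabs s) ->
    Rabs (RInt (kern q 1) a b) <= (b - a) * exp (- Rmin q (1 - q) * x)).
  { intros c e Hce Hs.
    apply abs_RInt_le_const; [assumption|apply kern_ex_RInt; lra|].
    intros s Hse. rewrite Rabs_pos_eq by (left; apply kern_pos; lra).
    apply kern_tail; auto. }
  destruct (Rle_dec a b) as [Hab|Hab].
  - rewrite (Rabs_pos_eq (b - a)) by lra. apply Hw; [assumption|].
    rewrite Rmin_left, Rmax_right in H; assumption.
  - assert (Hs : RInt (kern q 1) a b = - RInt (kern q 1) b a).
    { rewrite <- (@opp_RInt_swap R_CompleteNormedModule); [reflexivity|apply kern_ex_RInt; lra]. }
    rewrite Hs, Rabs_Ropp, (Rabs_left (b - a)) by lra.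
    replace (- (b - a)) with (a - b) by ring. apply Hw; [lra|].
    rewrite Rmin_right, Rmax_left in H by lra. assumption.
Qed.

(** The two windows differ by end pieces of length [Rabs tau], on which [Rabs s] is at least
    [N - Rabs tau]. *)
Lemma kern_shift (q tau N : R) : 0 < q < 1 -> Rabs tau <= N ->
  Rabs (RInt (kern q 1) (- N - tau) (N - tau) - RInt (kern q 1) (- N) N)
  <= 2 * Rabs tau * exp (- Rmin q (1 - q) * (N - Rabs tau)).
Proof.
  intros Hq HN.
  assert (Hex : forall a b, ex_RInt (kern q 1) a b) by (intros; apply kern_ex_RInt; lra).
  assert (Hch : forall a b c, RInt (kern q 1) a c = RInt (kern q 1) a b + RInt (kern q 1) b c).
  { intros. symmetry. apply (@RInt_Chasles R_CompleteNormedModule); auto. }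
  rewrite (Hch (- N - tau) (- N) (N - tau)), (Hch (- N) N (N - tau)).
  assert (H1 : Rabs (RInt (kern q 1) (- N - tau) (- N))
     <= Rabs tau * exp (- Rmin q (1 - q) * (N - Rabs tau))).
  { replace tau with (- N - (- N - tau)) at 2 by ring.
    apply kern_RInt_tail; [assumption|lra|]. intros s.
    unfold Rmin, Rmax, Rabs in *.
    repeat destruct Rle_dec; repeat destruct Rcase_abs; lra. }
  assert (H2 : Rabs (RInt (kern q 1) N (N - tau))
     <= Rabs tau * exp (- Rmin q (1 - q) * (N - Rabs tau))).
  { replace (Rabs tau * _) with (Rabs (N - tau - N) * exp (- Rmin q (1 - q) * (N - Rabs tau)))
      by (rewrite <- (Rabs_Ropp tau); do 2 f_equal; ring).
    apply kern_RInt_tail; [assumption|lra|]. intros s.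
    unfold Rmin, Rmax, Rabs in *.
    repeat destruct Rle_dec; repeat destruct Rcase_abs; lra. }
  replace (_ - _) with (RInt (kern q 1) (- N - tau) (- N) + RInt (kern q 1) N (N - tau)) by ring.
  eapply Rle_trans; [apply Rabs_triang|]. lra.
Qed.

(** By positivity, the integral over [[-1, 1]] is a lower bound uniform in [N]; it keeps the
    normalizing denominators away from 0. *)
Lemma kern_RInt_mass (q : R) : exists L, 0 < L /\
  forall N, 1 <= N -> L <= RInt (kern q 1) (- N) N.
Proof.
  assert (Hex : forall a b, ex_RInt (kern q 1) a b) by (intros; apply kern_ex_RInt; lra).
  assert (Hpos : forall a b, a <= b -> 0 <= RInt (kern q 1) a b).
  { intros. apply RInt_ge_0; auto. intros; left; apply kern_pos; lra. }
  exists (RInt (kern q 1) (-1) 1). split.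
  - apply RInt_gt_0; [lra|intros; apply kern_pos; lra|].
    intros; apply kern_continuous; lra.
  - intros N HN.
    rewrite <- (@RInt_Chasles R_CompleteNormedModule _ (- N) (-1) N); auto.
    rewrite <- (@RInt_Chasles R_CompleteNormedModule _ (-1) 1 N); auto.
    unfold plus; simpl.
    generalize (Hpos (- N) (-1) ltac:(lra)) (Hpos 1 N ltac:(lra)); lra.
Qed.

Lemma exp_decay (c : R) : 0 < c -> is_lim_seq (fun N => exp (- c * INR N)) 0.
Proof.
  intros Hc.
  apply is_lim_seq_le_le_loc with (fun _ => 0) (fun N => / c * / INR N).
  - exists 1%nat. intros N HN. split; [left; apply exp_pos|].
    apply le_INR in HN. simpl in HN.
    rewrite <- Rinv_mult. replace (- c * INR N) with (- (c * INR N)) by ring.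
    rewrite exp_Ropp. apply Rinv_le_contravar; [nra|].
    generalize (exp_ineq1_le (c * INR N)); lra.
  - apply is_lim_seq_const.
  - replace 0 with (/ c * 0) by ring.
    apply (is_lim_seq_scal_l _ (/ c) 0).
    apply (is_lim_seq_inv INR p_infty); [apply is_lim_seq_INR|discriminate].
Qed.

(** After scaling, the ratio is [Rpower t (q - 1)] times 1 plus a relative error: an exponentially
    small window shift over a denominator bounded below. *)
Lemma kern_ratio_lim (q t : R) : 0 < q < 1 -> 0 < t ->
  is_lim_seq (fun N => RInt (kern q t) (- INR N) (INR N) / RInt (kern q 1) (- INR N) (INR N))
    (Rpower t (q - 1)).
Proof.
  intros Hq Ht.
  destruct (kern_RInt_mass q) as [L [HL HLN]].
  set (m := Rmin q (1 - q)).
  assert (Hm : 0 < m) by (apply Rmin_pos; lra).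
  set (D := fun N => RInt (kern q 1) (- INR N - ln t) (INR N - ln t) - RInt (kern q 1) (- INR N) (INR N)).
  (* From [N0 + 1] on, [INR N] exceeds both [Rabs (ln t)], as [kern_shift] requires, and 1, as the
     mass bound requires. *)
  destruct (nfloor_ex (Rabs (ln t)) (Rabs_pos _)) as [N0 HN0].
  assert (Hloc : forall N, (N0 + 1 <= N)%nat -> Rabs (ln t) <= INR N /\ 1 <= INR N).
  { intros N HN. apply le_INR in HN. rewrite plus_INR in HN. simpl in HN.
    generalize (pos_INR N0); lra. }
  assert (Hlim : is_lim_seq (fun N => D N / RInt (kern q 1) (- INR N) (INR N)) 0).
  { apply is_lim_seq_abs_0.
    apply is_lim_seq_le_le_loc with (fun _ => 0)
      (fun N => (2 * Rabs (ln t) * exp (m * Rabs (ln t)) / L) * exp (- m * INR N)).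
    - exists (N0 + 1)%nat. intros N HN. destruct (Hloc N HN) as [H1 H2].
      split; [apply Rabs_pos|].
      assert (HLN' := HLN _ H2).
      unfold Rdiv at 1. rewrite Rabs_mult, Rabs_inv, (Rabs_pos_eq (RInt _ _ _)) by lra.
      replace (_ / L * _) with
        ((2 * Rabs (ln t) * exp (- m * (INR N - Rabs (ln t)))) * / L).
      2: { replace (- m * (INR N - Rabs (ln t))) with (m * Rabs (ln t) + - m * INR N) by ring.
           rewrite exp_plus. field. lra. }
      apply Rmult_le_compat; [apply Rabs_pos| |now apply kern_shift|].
      + left; apply Rinv_0_lt_compat; lra.
      + apply Rinv_le_contravar; lra.
    - apply is_lim_seq_const.
    - replace 0 with (2 * Rabs (ln t) * exp (m * Rabs (ln t)) / L * 0) by ring.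
      apply (is_lim_seq_scal_l _ _ 0), exp_decay, Hm. }
  apply is_lim_seq_ext_loc with
    (fun N => Rpower t (q - 1) * (1 + D N / RInt (kern q 1) (- INR N) (INR N))).
  - exists (N0 + 1)%nat. intros N HN. destruct (Hloc N HN) as [_ H2].
    assert (HLN' := HLN _ H2).
    rewrite (kern_RInt_scale q t) by exact Ht. unfold D. field. lra.
  - replace (Rpower t (q - 1)) with (Rpower t (q - 1) * (1 + 0)) at 1 by ring.
    apply (is_lim_seq_scal_l _ _ (1 + 0)), is_lim_seq_plus'; [apply is_lim_seq_const|exact Hlim].
Qed.

(* t^(q-1) is a limit of positive combinations of the resolvents 1/(t+s), hence inherits
   every inequality that these satisfy; at q = 0 it is the resolvent at s = 0. *)
Lemma resolvent_to_power (q : R) (m n : nat) (e u c t : nat -> R) :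
  0 <= q < 1 ->
  (forall i, (i < m)%nat -> 0 < u i) -> (forall x, (x < n)%nat -> 0 < t x) ->
  (forall s, 0 <= s -> rsum m (fun i => e i / (u i + s)) <= rsum n (fun x => c x / (t x + s))) ->
  rsum m (fun i => e i * Rpower (u i) (q - 1)) <= rsum n (fun x => c x * Rpower (t x) (q - 1)).
Proof.
  intros Hq0 Hu Ht Hres.
  assert (Hq : q = 0 \/ 0 < q < 1) by lra. clear Hq0.
  destruct Hq as [->|Hq].
  { rewrite (rsum_ext m _ (fun i => e i / (u i + 0))), (rsum_ext n _ (fun x => c x / (t x + 0))).
    - apply Hres; lra.
    - intros x Hx. rewrite Rplus_0_r. unfold Rdiv.
      replace (0 - 1) with (- (1)) by ring. rewrite Rpower_Ropp, Rpower_1; auto.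
    - intros i Hi. rewrite Rplus_0_r. unfold Rdiv.
      replace (0 - 1) with (- (1)) by ring. rewrite Rpower_Ropp, Rpower_1; auto. }
  set (L := fun N : nat => RInt (kern q 1) (- INR N) (INR N)).
  set (S := fun k (e u : nat -> R) (N : nat) =>
    rsum k (fun i => e i * (RInt (kern q (u i)) (- INR N) (INR N) / L N))).
  assert (Hlim : forall k e u, (forall i, (i < k)%nat -> 0 < u i) ->
    is_lim_seq (S k e u) (rsum k (fun i => e i * Rpower (u i) (q - 1)))).
  { intros k e' u' Hu'. apply rsum_lim. intros i Hi.
    apply (is_lim_seq_scal_l _ (e' i) (Rpower (u' i) (q - 1))), kern_ratio_lim; auto. }
  (* The alternative [L N <= 0] covers [N = 0], where the window is empty; it is discarded below,
     for [N >= 1]. *)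
  assert (HRI : forall k e u N, (forall i, (i < k)%nat -> 0 < u i) ->
    is_RInt (fun s => exp (q * s) * rsum k (fun i => e i / (u i + exp s))) (- INR N) (INR N)
      (L N * S k e u N) \/ L N <= 0).
  { intros k e' u' N Hu'. destruct (Rle_dec (L N) 0) as [H0|H0]; [now right|left].
    unfold S. rewrite <- rsum_scal.
    apply is_RInt_ext with (fun s => rsum k (fun i => e' i * kern q (u' i) s)).
    { intros s _. rewrite <- rsum_scal. apply rsum_ext. intros; unfold kern, Rdiv; ring. }
    replace (rsum k _) with (rsum k (fun i => RInt (fun s => e' i * kern q (u' i) s) (- INR N) (INR N))).
    - apply (rsum_RInt k (fun i s => e' i * kern q (u' i) s)). intros i Hi.
      apply @ex_RInt_scal, kern_ex_RInt; auto.
    - apply rsum_ext. intros i Hi.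
      rewrite (@RInt_scal R_CompleteNormedModule) by (apply kern_ex_RInt; auto).
      unfold scal; simpl; unfold mult; simpl. field. lra. }
  destruct (kern_RInt_mass q) as [L0 [HL0 HLN]].
  apply (is_lim_seq_le_loc (S m e u) (S n c t)
    (rsum m (fun i => e i * Rpower (u i) (q - 1)))
    (rsum n (fun x => c x * Rpower (t x) (q - 1)))); auto.
  exists 1%nat. intros N HN. apply le_INR in HN; simpl in HN.
  assert (HLpos : 0 < L N) by (generalize (HLN _ HN); unfold L; lra).
  destruct (HRI m e u N Hu) as [H1|H1]; [|lra].
  destruct (HRI n c t N Ht) as [H2|H2]; [|lra].
  (* Multiplied by [L N], both sides are integrals whose integrands compare pointwise, by the
     resolvent inequality at [exp s]. *)
  apply Rmult_le_reg_l with (L N); [assumption|].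
  apply (is_RInt_le _ _ (- INR N) (INR N) _ _ ltac:(lra) H1 H2).
  intros s _. apply Rmult_le_compat_l; [left; apply exp_pos|].
  apply Hres; left; apply exp_pos.
Qed.

(** * The variational formula *)

(** The tangent of [exp] at the weighted mean [m] of the logarithms gives
    [z >= exp m * (1 + ln z - m)]; averaging over [x] and [y] cancels the linear parts. *)
Lemma weighted_AMGM (a x y : R) : 0 < a < 1 -> 0 < x -> 0 < y ->
  Rpower x a * Rpower y (1 - a) <= a * x + (1 - a) * y.
Proof.
  intros Ha Hx Hy. unfold Rpower. rewrite <- exp_plus.
  set (m := a * ln x + (1 - a) * ln y).
  assert (H : forall z, 0 < z -> exp m * (1 + (ln z - m)) <= z).
  { intros z Hz. rewrite <- (exp_ln z) at 2 by assumption.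
    replace (ln z) with (m + (ln z - m)) at 2 by ring. rewrite exp_plus.
    apply Rmult_le_compat_l; [left; apply exp_pos|apply exp_ineq1_le]. }
  replace (exp m) with (a * (exp m * (1 + (ln x - m))) + (1 - a) * (exp m * (1 + (ln y - m))))
    by (unfold m; ring).
  apply Rplus_le_compat; apply Rmult_le_compat_l; auto; lra.
Qed.

Lemma rpow_pos (x y : R) : 0 < x -> rpow x y = Rpower x y.
Proof. intros H. unfold rpow. destruct Rlt_dec; [reflexivity|contradiction]. Qed.

Lemma rpow_0 (y : R) : rpow 0 y = 0.
Proof. unfold rpow. destruct Rlt_dec; [lra|reflexivity]. Qed.

Lemma Rpower_pos (x y : R) : 0 < Rpower x y.
Proof. apply exp_pos. Qed.

Lemma rpow_nonneg (x y : R) : 0 <= rpow x y.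
Proof. unfold rpow. destruct Rlt_dec; [left; apply Rpower_pos|lra]. Qed.

(* P^alpha Q^(1-alpha) is the infimum (alpha < 1) or supremum (alpha > 1) of this over w > 0. *)
Definition var_term (alpha P Q w : R) : R :=
  alpha * (P * Rpower w (1 - / alpha)) + (1 - alpha) * (w * Q).

(** Weighted AM-GM for [P * Rpower w (1 - / alpha)] and [w * Q]: in the geometric mean the powers of
    [w] cancel. *)
Lemma var_term_ge (alpha P Q w : R) :
  0 < alpha < 1 -> 0 <= P -> 0 <= Q -> 0 < w ->
  rpow P alpha * rpow Q (1 - alpha) <= var_term alpha P Q w.
Proof.
  intros Ha HP HQ Hw. unfold var_term.
  assert (Hr := Rpower_pos w (1 - / alpha)).
  destruct HP as [HP|<-]; [destruct HQ as [HQ|<-]|]; rewrite ?rpow_0.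
  2: { assert (0 <= alpha * (P * Rpower w (1 - / alpha))) by (repeat apply Rmult_le_pos; lra). lra. }
  2: { assert (0 <= (1 - alpha) * (w * Q)) by (repeat apply Rmult_le_pos; lra). lra. }
  rewrite !rpow_pos by assumption.
  replace (Rpower P alpha * Rpower Q (1 - alpha)) with
    (Rpower (P * Rpower w (1 - / alpha)) alpha * Rpower (w * Q) (1 - alpha)).
  - apply weighted_AMGM; auto; nra.
  - rewrite <- !Rpower_mult_distr, Rpower_mult by assumption.
    replace ((1 - / alpha) * alpha) with (- (1 - alpha)) by (field; lra).
    rewrite Rpower_Ropp. field. apply Rgt_not_eq, Rpower_pos.
Qed.

(** Weighted AM-GM with weight [/ alpha] for [P^alpha Q^(1-alpha)] and [w * Q]: the geometric mean
    is [P * Rpower w (1 - / alpha)]. Multiplying by [alpha] and rearranging gives the bound. *)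
Lemma var_term_le (alpha P Q w : R) :
  1 < alpha -> 0 <= P -> 0 <= Q -> (P <> 0 -> Q <> 0) -> 0 < w ->
  var_term alpha P Q w <= rpow P alpha * rpow Q (1 - alpha).
Proof.
  intros Ha HP HQ HPQ Hw. unfold var_term.
  destruct HP as [HP|<-]; cycle 1.
  { rewrite rpow_0. assert (0 <= (alpha - 1) * (w * Q)) by (repeat apply Rmult_le_pos; lra). lra. }
  assert (0 < Q) by (destruct HQ as [HQ|<-]; [assumption|lra]).
  rewrite !rpow_pos by assumption.
  assert (Hi : 0 < / alpha < 1).
  { split; [apply Rinv_0_lt_compat; lra|]. rewrite <- Rinv_1. apply Rinv_lt_contravar; lra. }
  assert (Hx := Rpower_pos P alpha). assert (Hy := Rpower_pos Q (1 - alpha)).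
  assert (H1 := weighted_AMGM (/ alpha) (Rpower P alpha * Rpower Q (1 - alpha)) (w * Q)
    Hi ltac:(nra) ltac:(nra)).
  rewrite <- !Rpower_mult_distr, !Rpower_mult in H1 by auto using Rpower_pos.
  rewrite Rinv_r, Rpower_1 in H1 by lra.
  replace ((1 - alpha) * / alpha) with (- (1 - / alpha)) in H1 by (field; lra).
  rewrite Rpower_Ropp in H1.
  assert (Hz := Rpower_pos Q (1 - / alpha)).
  replace (P * / Rpower Q (1 - / alpha) * (Rpower w (1 - / alpha) * Rpower Q (1 - / alpha)))
    with (P * Rpower w (1 - / alpha)) in H1 by (field; lra).
  apply (Rmult_le_compat_l alpha) in H1; [|lra].
  replace (alpha * (/ alpha * (Rpower P alpha * Rpower Q (1 - alpha)) + (1 - / alpha) * (w * Q)))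
    with (Rpower P alpha * Rpower Q (1 - alpha) + (alpha - 1) * (w * Q)) in H1 by (field; lra).
  lra.
Qed.

(** The weight [Rpower (P / Q) alpha] is the stationary point in [w]; there both products in
    [var_term] equal [P^alpha Q^(1-alpha)]. *)
Lemma var_term_opt (alpha P Q : R) : 0 < alpha -> 0 < P -> 0 < Q ->
  var_term alpha P Q (Rpower (P / Q) alpha) = rpow P alpha * rpow Q (1 - alpha).
Proof.
  intros Ha HP HQ. unfold var_term. rewrite !rpow_pos, Rpower_mult by assumption.
  unfold Rpower, Rdiv. rewrite ln_mult, ln_Rinv by auto using Rinv_0_lt_compat.
  replace (alpha * (1 - / alpha)) with (alpha - 1) by (field; lra).
  rewrite <- (exp_ln P) at 1 by assumption. rewrite <- (exp_ln Q) at 3 by assumption.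
  rewrite <- !exp_plus.
  replace (ln P + _) with (alpha * ln P + (1 - alpha) * ln Q) by ring.
  replace (alpha * _ + ln Q) with (alpha * ln P + (1 - alpha) * ln Q) by ring.
  ring.
Qed.

(** Only a multiple of a nonzero power of [w] is left, which takes every positive value: small ones
    approach the infimum 0 for [alpha < 1], large ones the infinite supremum for [alpha > 1]. *)
Lemma var_term_Q0 (alpha P K : R) : 0 < alpha -> alpha <> 1 -> 0 < P -> 0 < K ->
  exists w, 0 < w /\ var_term alpha P 0 w = K.
Proof.
  intros Ha Ha1 HP HK.
  exists (Rpower (K / (alpha * P)) (/ (1 - / alpha))). split; [apply Rpower_pos|].
  unfold var_term. rewrite Rpower_mult, Rinv_l, Rpower_1.
  - field. lra.
  - apply Rdiv_lt_0_compat; nra.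
  - intros H. apply Ha1. rewrite <- (Rinv_inv alpha). replace (/ alpha) with 1 by lra. apply Rinv_1.
Qed.

Lemma var_term_P0 (alpha Q eps : R) : 0 < alpha -> 0 <= Q -> 0 < eps ->
  exists w, 0 < w /\ Rabs (var_term alpha 0 Q w) <= eps.
Proof.
  intros Ha HQ He.
  assert (Hc : 0 < 1 + Q * (1 + Rabs (1 - alpha))) by (generalize (Rabs_pos (1 - alpha)); nra).
  (* The denominator dominates [Q * Rabs (1 - alpha)] and stays positive when [Q = 0]. *)
  exists (eps / (1 + Q * (1 + Rabs (1 - alpha)))). split; [now apply Rdiv_lt_0_compat|].
  unfold var_term. rewrite Rmult_0_l, Rmult_0_r, Rplus_0_l, !Rabs_mult.
  rewrite (Rabs_pos_eq Q), (Rabs_pos_eq (eps / _))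
    by (assumption || (left; now apply Rdiv_lt_0_compat)).
  replace (_ * _) with (eps * (Q * Rabs (1 - alpha)) / (1 + Q * (1 + Rabs (1 - alpha))))
    by (field; lra).
  apply Rmult_le_reg_r with (1 + Q * (1 + Rabs (1 - alpha))); [assumption|].
  unfold Rdiv. rewrite Rmult_assoc, Rinv_l, Rmult_1_r by lra. nra.
Qed.

Lemma var_term_near_le (alpha P Q eps : R) :
  0 < alpha < 1 -> 0 <= P -> 0 <= Q -> 0 < eps ->
  exists w, 0 < w /\ var_term alpha P Q w <= rpow P alpha * rpow Q (1 - alpha) + eps.
Proof.
  intros Ha HP HQ He.
  assert (H0 : 0 <= rpow P alpha * rpow Q (1 - alpha)) by auto using Rmult_le_pos, rpow_nonneg.
  destruct HP as [HP|<-]; [destruct HQ as [HQ|<-]|].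
  - exists (Rpower (P / Q) alpha). split; [apply Rpower_pos|].
    rewrite var_term_opt by lra. lra.
  - destruct (var_term_Q0 alpha P eps) as [w [Hw Hv]]; try lra.
    exists w. split; [assumption|lra].
  - destruct (var_term_P0 alpha Q eps) as [w [Hw Hv]]; try lra.
    exists w. split; [assumption|]. generalize (Rle_abs (var_term alpha 0 Q w)); lra.
Qed.

(** The last clause serves the case where [Qalpha] is [PInf]: one term must then be made arbitrarily
    large, while [rpow 0 (1 - alpha) = 0] makes the other bound blind to it. *)
Lemma var_term_near_ge (alpha P Q eps K : R) :
  1 < alpha -> 0 <= P -> 0 <= Q -> 0 < eps -> 0 < K ->
  exists w, 0 < w /\ rpow P alpha * rpow Q (1 - alpha) - eps <= var_term alpha P Q w /\
    (P <> 0 -> Q = 0 -> K <= var_term alpha P Q w).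
Proof.
  intros Ha HP HQ He HK.
  destruct HP as [HP|<-]; [destruct HQ as [HQ|<-]|].
  - exists (Rpower (P / Q) alpha). split; [apply Rpower_pos|].
    rewrite var_term_opt by lra. split; lra.
  - destruct (var_term_Q0 alpha P K) as [w [Hw Hv]]; try lra.
    exists w. rewrite rpow_0. repeat split; lra.
  - destruct (var_term_P0 alpha Q eps) as [w [Hw Hv]]; try lra.
    exists w. rewrite rpow_0. split; [assumption|split; [|lra]].
    generalize (Rle_abs (- var_term alpha 0 Q w)); rewrite Rabs_Ropp; lra.
Qed.

(** * The variational formula summed over outcomes *)

Definition var_sum (alpha : R) (n : nat) (P Q w : nat -> R) : R :=
  rsum n (fun x => var_term alpha (P x) (Q x) (w x)).

Lemma var_sum_split (alpha : R) (n : nat) (P Q w : nat -> R) :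
  var_sum alpha n P Q w =
  alpha * rsum n (fun x => P x * Rpower (w x) (1 - / alpha)) +
  (1 - alpha) * rsum n (fun x => w x * Q x).
Proof. unfold var_sum, var_term. now rewrite rsum_plus, !rsum_scal. Qed.

Lemma choose_weights (n : nat) (R0 : nat -> R -> Prop) :
  (forall x, (x < n)%nat -> exists w, 0 < w /\ R0 x w) ->
  exists w : nat -> R, forall x, (x < n)%nat -> 0 < w x /\ R0 x (w x).
Proof.
  intros H.
  assert (H' : forall x, exists w, (x < n)%nat -> 0 < w /\ R0 x w).
  { intros x. destruct (Nat.lt_ge_cases x n) as [Hx|Hx].
    - destruct (H x Hx) as [w Hw]. now exists w.
    - exists 0. lia. }
  exists (fun x => proj1_sig (constructive_indefinite_description _ (H' x))).
  intros x. destruct constructive_indefinite_description; auto.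
Qed.

Lemma rsum_ge_term (n : nat) (f : nat -> R) (eps : R) (x : nat) :
  0 <= eps -> (x < n)%nat -> (forall k, (k < n)%nat -> - eps <= f k) ->
  f x - INR n * eps <= rsum n f.
Proof.
  intros He. revert x. induction n as [|n IH]; intros x Hx H; [lia|].
  rewrite S_INR. simpl.
  assert (Hn : - (INR n * eps) <= rsum n f).
  { replace (- (INR n * eps)) with (INR n * - eps) by ring.
    rewrite <- rsum_const. apply rsum_le. auto. }
  destruct (Nat.eq_dec x n) as [->|Hxn]; [lra|].
  generalize (IH x ltac:(lia) ltac:(auto)) (H n ltac:(lia)); lra.
Qed.

Lemma var_sum_lt_one (alpha N : R) (n : nat) (P Q : nat -> R) :
  0 < alpha < 1 ->
  (forall x, (x < n)%nat -> 0 <= P x /\ 0 <= Q x) ->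
  ~ ERle (Fin N) (Qalpha alpha n P Q) ->
  exists w, (forall x, (x < n)%nat -> 0 < w x) /\ var_sum alpha n P Q w < N.
Proof.
  intros Ha HPQ HN. unfold Qalpha in HN. destruct Rlt_dec; [lra|]. simpl in HN.
  set (s := rsum n _) in HN.
  (* The slack is split into [INR n + 1] shares and only [INR n] are spent, which keeps the
     inequality strict. *)
  set (eps := (N - s) / (INR n + 1)).
  assert (Hn := pos_INR n).
  assert (He : 0 < eps) by (apply Rdiv_lt_0_compat; lra).
  destruct (choose_weights n (fun x w => var_term alpha (P x) (Q x) w <=
    rpow (P x) alpha * rpow (Q x) (1 - alpha) + eps)) as [w Hw].
  { intros x Hx. apply var_term_near_le; auto; now apply HPQ. }
  exists w. split; [intros; now apply Hw|].
  apply Rle_lt_trans with (s + INR n * eps).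
  - unfold var_sum, s. rewrite <- rsum_const, <- rsum_plus. apply rsum_le. intros; now apply Hw.
  - replace N with (s + (INR n + 1) * eps) by (unfold eps; field; lra). lra.
Qed.

Lemma var_sum_gt_one (alpha N : R) (n : nat) (P Q : nat -> R) :
  1 < alpha ->
  (forall x, (x < n)%nat -> 0 <= P x /\ 0 <= Q x) ->
  ~ ERle (Qalpha alpha n P Q) (Fin N) ->
  exists w, (forall x, (x < n)%nat -> 0 < w x) /\ N < var_sum alpha n P Q w.
Proof.
  intros Ha HPQ HN. unfold Qalpha in HN. destruct Rlt_dec; [|lra].
  set (s := rsum n _) in HN.
  (* The value 1 is taken only when [s <= N], which the hypothesis permits only if [Qalpha] is
     [PInf]. In that infinite case a single term of size [K] outweighs [N] and the losses of the
     other terms. *)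
  set (eps := if Rlt_dec N s then (s - N) / (INR n + 1) else 1).
  set (K := Rmax 1 (N + INR n * eps + 1)).
  assert (Hn := pos_INR n).
  assert (He : 0 < eps).
  { unfold eps. destruct Rlt_dec; [apply Rdiv_lt_0_compat; lra|lra]. }
  assert (HK : 0 < K) by (generalize (Rmax_l 1 (N + INR n * eps + 1)); unfold K; lra).
  destruct (choose_weights n (fun x w =>
    rpow (P x) alpha * rpow (Q x) (1 - alpha) - eps <= var_term alpha (P x) (Q x) w /\
    (P x <> 0 -> Q x = 0 -> K <= var_term alpha (P x) (Q x) w))) as [w Hw].
  { intros x Hx. apply var_term_near_ge; auto; now apply HPQ. }
  exists w. split; [intros; now apply Hw|].
  destruct excluded_middle_informative as [[x [Hx [HP HQ]]]|Hac].
  - apply Rlt_le_trans with (var_term alpha (P x) (Q x) (w x) - INR n * eps).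
    + destruct (Hw x Hx) as [_ [_ H]]. specialize (H HP HQ).
      generalize (Rmax_r 1 (N + INR n * eps + 1)); unfold K in H; lra.
    + apply (rsum_ge_term n (fun x => var_term alpha (P x) (Q x) (w x)) eps); [lra|assumption|].
      intros k Hk. destruct (Hw k Hk) as [_ [H _]].
      generalize (Rmult_le_pos _ _ (rpow_nonneg (P k) alpha) (rpow_nonneg (Q k) (1 - alpha))).
      lra.
  - simpl in HN. apply Rlt_le_trans with (s - INR n * eps).
    + assert (Heps : eps = (s - N) / (INR n + 1)) by (unfold eps; destruct Rlt_dec; lra).
      replace N with (s - (INR n + 1) * eps) by (rewrite Heps; field; lra). lra.
    + replace (s - INR n * eps) with (s + INR n * - eps) by ring.
      unfold var_sum, s. rewrite <- rsum_const, <- rsum_plus. apply rsum_le.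
      intros k Hk. destruct (Hw k Hk) as [_ [H _]]. lra.
Qed.

Lemma Qalpha_lt_one_le (alpha : R) (n : nat) (P Q w : nat -> R) :
  0 < alpha < 1 ->
  (forall x, (x < n)%nat -> 0 <= P x /\ 0 <= Q x) -> (forall x, (x < n)%nat -> 0 < w x) ->
  ERle (Qalpha alpha n P Q) (Fin (var_sum alpha n P Q w)).
Proof.
  intros Ha HPQ Hw. unfold Qalpha. destruct Rlt_dec; [lra|]. simpl.
  apply rsum_le. intros x Hx. apply var_term_ge; auto; now apply HPQ.
Qed.

Lemma Qalpha_gt_one_ge (alpha : R) (n : nat) (P Q w : nat -> R) :
  1 < alpha ->
  (forall x, (x < n)%nat -> 0 <= P x /\ 0 <= Q x) -> (forall x, (x < n)%nat -> 0 < w x) ->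
  ERle (Fin (var_sum alpha n P Q w)) (Qalpha alpha n P Q).
Proof.
  intros Ha HPQ Hw. unfold Qalpha. destruct Rlt_dec; [|lra].
  destruct excluded_middle_informative as [_|Hac]; [exact I|]. simpl.
  apply rsum_le. intros x Hx. apply var_term_le; auto; try now apply HPQ.
  intros HP HQ. apply Hac. now exists x.
Qed.

(** * Replacing a general measurement by a projective one *)

Lemma ERle_trans (x y z : ER) : ERle x y -> ERle y z -> ERle x z.
Proof. destruct x, y, z; simpl; try tauto; lra. Qed.

Lemma ERle_antisym (x y : ER) : ERle x y -> ERle y x -> x = y.
Proof. destruct x, y; simpl; try tauto. intros; f_equal; lra. Qed.

Lemma ERle_refl (x : ER) : ERle x x.
Proof. destruct x; simpl; auto; lra. Qed.

Lemma induced_pair_nonneg (d n : nat) (M : nat -> Mat) (rho sigma : Mat) :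
  povm d n M -> psd d rho -> psd d sigma ->
  forall x, (x < n)%nat -> 0 <= induced d M rho x /\ 0 <= induced d M sigma x.
Proof. intros. split; eapply induced_nonneg; eauto. Qed.

(* w |-> w^(1-1/alpha) is operator concave for alpha > 1. *)
Lemma projective_gt_one (d n : nat) (M : nat -> Mat) (rho sigma : Mat) (alpha N : R) :
  povm d n M -> psd d rho -> psd d sigma -> 1 < alpha ->
  ~ ERle (Qalpha alpha n (induced d M rho) (induced d M sigma)) (Fin N) ->
  exists P, proj_family d P /\
    ~ ERle (Qalpha alpha d (induced d P rho) (induced d P sigma)) (Fin N).
Proof.
  intros HM Hr Hs Ha HN.
  destruct (var_sum_gt_one alpha N n _ _ Ha (induced_pair_nonneg d n M rho sigma HM Hr Hs) HN)
    as [w [Hw HNw]].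
  destruct (spectral_family HM Hw) as [P [b [HP [Hb H]]]].
  exists P. split; [assumption|]. intros Hle.
  assert (HPp := induced_pair_nonneg d d P rho sigma (proj_family_povm HP) Hr Hs).
  assert (Hge := Qalpha_gt_one_ge alpha d _ _ b Ha HPp Hb).
  assert (Hbad := ERle_trans _ _ _ Hge Hle). simpl in Hbad.
  destruct (H rho Hr) as [Htr [_ Hres]]. destruct (H sigma Hs) as [_ [Hlin _]].
  rewrite var_sum_split, Hlin in Hbad. rewrite var_sum_split in HNw.
  assert (Hi : 0 < / alpha < 1).
  { split; [apply Rinv_0_lt_compat; lra|]. rewrite <- Rinv_1. apply Rinv_lt_contravar; lra. }
  assert (Hpow : forall z, 0 < z -> Rpower z (1 - / alpha) = z * Rpower z (1 - / alpha - 1)).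
  { intros z Hz. rewrite <- (Rpower_1 z) at 2 by assumption.
    rewrite <- Rpower_plus. f_equal; ring. }
  (* One factor of the weight moves into the coefficients, so the inequality to supply concerns
     [t / (t + s) = 1 - s / (t + s)]. As the totals agree, the sign of [- s] reverses the resolvent
     inequality, and the POVM side becomes the smaller one. *)
  assert (Hj := resolvent_to_power (1 - / alpha) n d
    (fun x => induced d M rho x * w x) w (fun i => induced d P rho i * b i) b
    ltac:(lra) Hw Hb).
  enough (rsum n (fun x => induced d M rho x * Rpower (w x) (1 - / alpha)) <=
          rsum d (fun i => induced d P rho i * Rpower (b i) (1 - / alpha))) by nra.
  rewrite (rsum_ext n _ (fun x => induced d M rho x * w x * Rpower (w x) (1 - / alpha - 1)))
    by (intros x Hx; rewrite (Hpow (w x)) by auto; ring).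
  rewrite (rsum_ext d _ (fun i => induced d P rho i * b i * Rpower (b i) (1 - / alpha - 1)))
    by (intros i Hi'; rewrite (Hpow (b i)) by auto; ring).
  apply Hj. intros s Hs0. specialize (Hres s Hs0).
  rewrite (rsum_ext n _ (fun x => induced d M rho x + - s * (induced d M rho x / (w x + s))))
    by (intros x Hx; specialize (Hw x Hx); field; lra).
  rewrite (rsum_ext d _ (fun i => induced d P rho i + - s * (induced d P rho i / (b i + s))))
    by (intros i Hi'; specialize (Hb i Hi'); field; lra).
  rewrite !rsum_plus, !rsum_scal, Htr. nra.
Qed.

(* w |-> w^(1-1/alpha) is operator convex for 1/2 <= alpha < 1. *)
Lemma projective_half_one (d n : nat) (M : nat -> Mat) (rho sigma : Mat) (alpha N : R) :
  povm d n M -> psd d rho -> psd d sigma -> / 2 <= alpha < 1 ->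
  ~ ERle (Fin N) (Qalpha alpha n (induced d M rho) (induced d M sigma)) ->
  exists P, proj_family d P /\
    ~ ERle (Fin N) (Qalpha alpha d (induced d P rho) (induced d P sigma)).
Proof.
  intros HM Hr Hs Ha HN.
  assert (Ha01 : 0 < alpha < 1) by lra.
  destruct (var_sum_lt_one alpha N n _ _ Ha01 (induced_pair_nonneg d n M rho sigma HM Hr Hs) HN)
    as [w [Hw HNw]].
  destruct (spectral_family HM Hw) as [P [b [HP [Hb H]]]].
  exists P. split; [assumption|]. intros Hle.
  assert (HPp := induced_pair_nonneg d d P rho sigma (proj_family_povm HP) Hr Hs).
  assert (Hge := Qalpha_lt_one_le alpha d _ _ b Ha01 HPp Hb).
  assert (Hbad := ERle_trans _ _ _ Hle Hge). simpl in Hbad.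
  destruct (H rho Hr) as [_ [_ Hres]]. destruct (H sigma Hs) as [_ [Hlin _]].
  rewrite var_sum_split, Hlin in Hbad. rewrite var_sum_split in HNw.
  assert (Hi : 1 < / alpha <= 2).
  { split; [rewrite <- Rinv_1; apply Rinv_lt_contravar; lra|].
    rewrite <- (Rinv_inv 2). apply Rinv_le_contravar; lra. }
  (* The exponent parameter [2 - / alpha] lies in [[0, 1)] exactly when [/ 2 <= alpha < 1]; the
     endpoint [alpha = / 2] is the bare resolvent. *)
  assert (Hj := resolvent_to_power (1 - / alpha + 1) d n
    (induced d P rho) b (induced d M rho) w ltac:(lra) Hb Hw Hres).
  replace (1 - / alpha + 1 - 1) with (1 - / alpha) in Hj by ring.
  nra.
Qed.

Lemma Qalpha_swap (alpha : R) (n : nat) (P Q : nat -> R) : 0 < alpha < 1 ->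
  Qalpha alpha n P Q = Qalpha (1 - alpha) n Q P.
Proof.
  intros Ha. unfold Qalpha. do 2 (destruct Rlt_dec; [lra|]). f_equal.
  apply rsum_ext. intros. replace (1 - (1 - alpha)) with alpha by ring. ring.
Qed.

Lemma projective_lt_one (d n : nat) (M : nat -> Mat) (rho sigma : Mat) (alpha N : R) :
  povm d n M -> psd d rho -> psd d sigma -> 0 < alpha < 1 ->
  ~ ERle (Fin N) (Qalpha alpha n (induced d M rho) (induced d M sigma)) ->
  exists P, proj_family d P /\
    ~ ERle (Fin N) (Qalpha alpha d (induced d P rho) (induced d P sigma)).
Proof.
  intros HM Hr Hs Ha HN.
  destruct (Rle_dec (/ 2) alpha) as [Hh|Hh].
  - apply (projective_half_one d n M); auto; lra.
  - rewrite Qalpha_swap in HN by assumption.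
    destruct (projective_half_one d n M sigma rho (1 - alpha) N) as [P [HP HPN]]; auto; [lra|].
    exists P. split; [assumption|]. now rewrite Qalpha_swap by assumption.
Qed.

(** * Suprema and infima in the extended reals *)

(** Existence is what makes the [epsilon] in [ER_sup] denote an actual supremum. The real case is
    [completeness]; sets that contain [PInf], have no finite element or are unbounded are treated
    apart. *)
Lemma is_sup_exists (S : ER -> Prop) : exists v, is_sup S v.
Proof.
  destruct (classic (S PInf)) as [HP|HP].
  { exists PInf. split; [intros [| |]; simpl; auto|intros u Hu; exact (Hu _ HP)]. }
  destruct (classic (exists r, S (Fin r))) as [[r0 Hr0]|Hne].
  2: { exists NInf. split; [|intros; exact I].
       intros [r| |] Hx; simpl; auto. apply Hne; now exists r. }
  destruct (classic (bound (fun r => S (Fin r)))) as [Hb|Hb].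
  - destruct (completeness _ Hb (ex_intro _ r0 Hr0)) as [l [Hl1 Hl2]].
    exists (Fin l). split.
    + intros [r| |] Hx; simpl; auto.
    + intros [r| |] Hu; simpl; auto.
      * apply Hl2. intros x Hx. apply (Hu _ Hx).
      * apply (Hu _ Hr0).
  - exists PInf. split; [intros [| |]; simpl; auto|].
    intros [r| |] Hu; simpl; auto.
    + apply Hb. exists r. intros x Hx. apply (Hu _ Hx).
    + apply (Hu _ Hr0).
Qed.

Definition ERopp (x : ER) : ER :=
  match x with Fin r => Fin (- r) | PInf => NInf | NInf => PInf end.

Lemma ERopp_le (x y : ER) : ERle (ERopp x) y <-> ERle (ERopp y) x.
Proof. destruct x, y; simpl; try tauto; split; lra. Qed.

Lemma ERopp_le_r (x y : ER) : ERle x (ERopp y) <-> ERle y (ERopp x).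
Proof. destruct x, y; simpl; try tauto; split; lra. Qed.

Lemma ERopp_invol (x : ER) : ERopp (ERopp x) = x.
Proof. destruct x; simpl; auto. f_equal; ring. Qed.

Lemma is_inf_exists (S : ER -> Prop) : exists v, is_inf S v.
Proof.
  destruct (is_sup_exists (fun x => S (ERopp x))) as [v [Hv1 Hv2]].
  exists (ERopp v). split.
  - intros x Hx. apply ERopp_le, Hv1. now rewrite ERopp_invol.
  - intros u Hu. apply ERopp_le_r, Hv2. intros x Hx. apply ERopp_le_r. auto.
Qed.

Lemma ER_sup_is_sup (S : ER -> Prop) : is_sup S (ER_sup S).
Proof. exact (epsilon_spec (inhabits PInf) (is_sup S) (is_sup_exists S)). Qed.

Lemma ER_inf_is_inf (S : ER -> Prop) : is_inf S (ER_inf S).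
Proof. exact (epsilon_spec (inhabits PInf) (is_inf S) (is_inf_exists S)). Qed.

Lemma is_sup_unique (S : ER -> Prop) (v w : ER) : is_sup S v -> is_sup S w -> v = w.
Proof. intros [Hv1 Hv2] [Hw1 Hw2]. apply ERle_antisym; auto. Qed.

(* Dfrom alpha is one half of a Galois connection, so that it carries suprema
   (infima when alpha < 1) to suprema. *)
Lemma Dfrom_adjoint_gt (alpha : R) (u : ER) : 1 < alpha ->
  exists g, forall q, ERle (Dfrom alpha q) u <-> ERle q g.
Proof.
  (* For [u = NInf] the threshold is 0, because [Dfrom] sends every nonpositive real to [NInf] when
     [alpha > 1]. *)
  intros Ha. exists match u with
    | Fin r => Fin (exp ((alpha - 1) * r)) | PInf => PInf | NInf => Fin 0 end.
  intros q. destruct u as [r| |], q as [s| |]; simpl;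
    repeat destruct Rlt_dec; simpl; try tauto; try lra.
  - rewrite Rle_div_l by lra. rewrite (Rmult_comm r). split; intros H.
    + rewrite <- (exp_ln s) by assumption. destruct H as [H|H].
      * left; now apply exp_increasing.
      * rewrite H; lra.
    + apply Rnot_lt_le. intros H'. apply exp_increasing in H'. rewrite exp_ln in H'; lra.
  - generalize (exp_pos ((alpha - 1) * r)); split; intros; auto; lra.
Qed.

Lemma Dfrom_adjoint_lt (alpha : R) (u : ER) : alpha < 1 ->
  exists g, forall q, ERle (Dfrom alpha q) u <-> ERle g q.
Proof.
  (* For [alpha < 1] the order reverses, and [PInf] is the only value sent to [NInf]. *)
  intros Ha. exists match u with
    | Fin r => Fin (exp ((alpha - 1) * r)) | PInf => NInf | NInf => PInf end.
  intros q. destruct u as [r| |], q as [s| |]; simpl;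
    repeat destruct Rlt_dec; simpl; try tauto; try lra.
  - replace (ln s / (alpha - 1)) with (- ln s / (1 - alpha)) by (field; lra).
    rewrite Rle_div_l by lra. split; intros H.
    + rewrite <- (exp_ln s) by assumption.
      destruct (Rle_lt_or_eq_dec ((alpha - 1) * r) (ln s)) as [H'|H']; [lra| |].
      * left; now apply exp_increasing.
      * rewrite H'; lra.
    + apply Rnot_lt_le. intros H'.
      assert (H2 : ln s < (alpha - 1) * r) by lra.
      apply exp_increasing in H2. rewrite exp_ln in H2; lra.
  - generalize (exp_pos ((alpha - 1) * r)); split; intros; [tauto|lra].
Qed.

Theorem theorem4 (d : nat) (rho sigma : Mat) (alpha : R) :
  density d rho -> psd d sigma -> 0 < alpha -> alpha <> 1 ->
  D_proj d alpha rho sigma = D_meas d alpha rho sigma.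
Proof.
  intros [Hr _] Hs Ha Ha1.
  (* It suffices that the projective quantity is itself a supremum of the measured values. *)
  apply (is_sup_unique (measured_set d alpha rho sigma)); [|apply ER_sup_is_sup].
  unfold D_proj, Q_proj. destruct (Rlt_dec 1 alpha) as [Hgt|Hlt].
  - destruct (ER_sup_is_sup (Qproj_set d alpha rho sigma)) as [Hub Hleast].
    set (q := ER_sup _) in *.
    assert (Hmeas : forall n M, povm d n M ->
      ERle (Qalpha alpha n (induced d M rho) (induced d M sigma)) q).
    { intros n M HM. apply NNPP. intros Hn.
      (* A real [N] separating [q] from the larger measured value: [q] itself if finite, otherwise
         any real below that value. *)
      assert (HN : exists N, ~ ERle (Qalpha alpha n (induced d M rho) (induced d M sigma)) (Fin N)
        /\ ERle q (Fin N)).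
      { destruct q as [N| |]; [exists N; simpl; split; [assumption|lra] | | ].
        - exfalso. apply Hn. now destruct Qalpha.
        - destruct Qalpha as [s| |]; [exists (s - 1)|exists 0|]; simpl in *; split; auto; lra. }
      destruct HN as [N [HN HqN]].
      destruct (projective_gt_one d n M rho sigma alpha N) as [P [HP HPN]]; auto.
      apply HPN. apply ERle_trans with q; [|assumption]. apply Hub. now exists P. }
    split.
    + intros v [n [M [HM ->]]]. unfold renyi.
      (* The adjunction at [Dfrom alpha q] itself yields monotonicity of [Dfrom]. *)
      destruct (Dfrom_adjoint_gt alpha (Dfrom alpha q) Hgt) as [g Hg].
      apply Hg, ERle_trans with q; [now apply Hmeas|].
      apply Hg. apply ERle_refl.
    + intros u Hu. destruct (Dfrom_adjoint_gt alpha u Hgt) as [g Hg].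
      apply Hg, Hleast. intros x [P [HP ->]]. apply Hg, Hu.
      exists d, P. split; [now apply proj_family_povm|reflexivity].
  - assert (Ha' : 0 < alpha < 1) by lra.
    destruct (ER_inf_is_inf (Qproj_set d alpha rho sigma)) as [Hlb Hgreatest].
    set (q := ER_inf _) in *.
    assert (Hmeas : forall n M, povm d n M ->
      ERle q (Qalpha alpha n (induced d M rho) (induced d M sigma))).
    { intros n M HM. apply NNPP. intros Hn.
      assert (HN : exists N, ~ ERle (Fin N) (Qalpha alpha n (induced d M rho) (induced d M sigma))
        /\ ERle (Fin N) q).
      { destruct q as [N| |]; [exists N; simpl; split; [assumption|lra] | | ].
        - destruct Qalpha as [s| |]; [exists (s + 1)| |exists 0]; simpl in *; split; auto; try lra.
        - exfalso. now apply Hn. }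
      destruct HN as [N [HN HqN]].
      destruct (projective_lt_one d n M rho sigma alpha N) as [P [HP HPN]]; auto.
      apply HPN. apply ERle_trans with q; [assumption|]. apply Hlb. now exists P. }
    split.
    + intros v [n [M [HM ->]]]. unfold renyi.
      destruct (Dfrom_adjoint_lt alpha (Dfrom alpha q) (proj2 Ha')) as [g Hg].
      apply Hg, ERle_trans with q; [|now apply Hmeas].
      apply Hg. apply ERle_refl.
    (* An upper bound [u] of the measured values bounds the projective ones in particular; the
       adjunction turns it into a lower bound [g] of the set whose infimum is [q]. *)
    + intros u Hu. destruct (Dfrom_adjoint_lt alpha u (proj2 Ha')) as [g Hg].
      apply Hg, Hgreatest. intros x [P [HP ->]]. apply Hg, Hu.
      exists d, P. split; [now apply proj_family_povm|reflexivity].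
Qed.
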